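(* Let $A\subseteq \mathbb{R}$. Then $H(A)$ is semi-stratifiable if and only if $\mathbb{R}\setminus A$ is countable.
   Context: For $A\subseteq\mathbb{R}$, the Hattori space $H(A)$ is the set $\mathbb{R}$ with the topology $\tau(A)$ in which a point $x\in A$ has the local base $\{(x-\varepsilon,x+\varepsilon) : \varepsilon>0\}$ and a point $x\in\mathbb{R}\setminus A$ has the local base $\{[x,x+\varepsilon) : \varepsilon>0\}$. A space $X$ is semi-stratifiable if there is a function $G$ assigning to each $n\in\mathbb{N}$ and each closed set $H\subseteq X$ an open set $G(n,H)\supseteq H$ such that $H=\bigcap_{n} G(n,H)$, and $G(n,H)\subseteq G(n,K)$ whenever $H\subseteq K$ are closed. ''Countable'' means of cardinality at most $\aleph_0$. *)

(* Defs.v *)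
From HB Require Import structures.
From mathcomp Require Import all_boot all_order all_algebra.
From mathcomp Require Import all_classical all_reals all_analysis.

Set Implicit Arguments.
Unset Strict Implicit.
Unset Printing Implicit Defensive.

Import Order.TTheory GRing.Theory Num.Theory.

Local Open Scope classical_set_scope.
Local Open Scope ring_scope.

Definition hattori_base (R : realType) (A : set R) (x e : R) : set R :=
  [set` if x \in A then `]x - e, x + e[ else `[x, x + e[].

Section HattoriBase.
Context (R : realType) (A : set R).
Implicit Types x y e : R.

Lemma hattori_base_refl x e : 0 < e -> hattori_base A x e x.
Proof.
move=> e0; rewrite /hattori_base; case: ifP => _ /=.
  by rewrite in_itv /= ltrBlDr !ltrDl e0.
by rewrite in_itv /= lexx ltrDl.
Qed.

Lemma hattori_baseS x e e' : e <= e' ->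
  hattori_base A x e `<=` hattori_base A x e'.
Proof.
move=> ee' y; rewrite /hattori_base; case: ifP => _ /=; rewrite !in_itv /=.
  move=> /andP[h1 h2]; apply/andP; split.
    by apply: le_lt_trans h1; rewrite lerD2l lerN2.
  by apply: lt_le_trans h2 _; rewrite lerD2l.
by move=> /andP[-> h2] /=; apply: lt_le_trans h2 _; rewrite lerD2l.
Qed.

Lemma hattori_base_sub x e y : hattori_base A x e y ->
  exists2 d, 0 < d & hattori_base A y d `<=` hattori_base A x e.
Proof.
rewrite {1}/hattori_base; case: (boolP (x \in A)) => xA /=; rewrite in_itv /=.
  move=> /andP[h1 h2]; pose d := Num.min (y - (x - e)) (x + e - y).
  have d0 : 0 < d by rewrite lt_min !subr_gt0 h1 h2.
  have dl : d <= y - (x - e) by rewrite ge_min lexx.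
  have dr : d <= x + e - y by rewrite ge_min lexx orbT.
  exists d => // z; rewrite /hattori_base xA.
  case: ifP => _ /=; rewrite !in_itv /= => /andP[h3 h4]; apply/andP; split.
  - by apply: le_lt_trans h3; rewrite lerBrDr addrC -lerBrDr.
  - by apply: lt_le_trans h4 _; rewrite addrC -lerBrDr.
  - exact: lt_le_trans h1 h3.
  - by apply: lt_le_trans h4 _; rewrite addrC -lerBrDr.
move=> /andP[]; rewrite le_eqVlt => /predU1P[<- h2|h1 h2].
  by exists e => //; rewrite ltrDl in h2.
pose d := Num.min (y - x) (x + e - y).
have d0 : 0 < d by rewrite lt_min !subr_gt0 h1 h2.
have dl : d <= y - x by rewrite ge_min lexx.
have dr : d <= x + e - y by rewrite ge_min lexx orbT.
exists d => // z; rewrite /hattori_base (negbTE xA).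
case: ifP => _ /=; rewrite !in_itv /= => /andP[h3 h4]; apply/andP; split.
- by apply/ltW; apply: le_lt_trans h3; rewrite lerBrDr addrC -lerBrDr.
- by apply: lt_le_trans h4 _; rewrite addrC -lerBrDr.
- exact: ltW (lt_le_trans h1 h3).
- by apply: lt_le_trans h4 _; rewrite addrC -lerBrDr.
Qed.

End HattoriBase.

Definition hattori (R : realType) (A : set R) : Type := R.

Section HattoriTopology.
Context (R : realType) (A : set R).

HB.instance Definition _ := Choice.on (hattori A).

Definition hattori_nbhs (x : hattori A) : set_system (hattori A) :=
  filter_from [set e : R | 0 < e] (hattori_base A x).

HB.instance Definition _ := hasNbhs.Build (hattori A) hattori_nbhs.

Let hattori_nbhs_filter (x : hattori A) : ProperFilter (nbhs x).
Proof.
apply: filter_from_proper; last first.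
  by move=> e e0; exists x; exact: hattori_base_refl.
apply: filter_from_filter; first by exists 1; exact: ltr01.
move=> e e' /= e0 e'0; exists (Num.min e e'); first by rewrite /= lt_min e0 e'0.
by move=> y xy; split; apply: hattori_baseS xy; rewrite ge_min lexx ?orbT.
Qed.

Let hattori_nbhs_singleton (x : hattori A) (U : set (hattori A)) :
  nbhs x U -> U x.
Proof. by move=> [e /= e0]; apply; exact: hattori_base_refl. Qed.

Let hattori_nbhs_nbhs (x : hattori A) (U : set (hattori A)) :
  nbhs x U -> nbhs x (nbhs^~ U).
Proof.
move=> [e /= e0 xU]; exists e => // y /hattori_base_sub[d d0 yd].
by exists d => //; exact: subset_trans xU.
Qed.

HB.instance Definition _ := Nbhs_isNbhsTopological.Build (hattori A)
  hattori_nbhs_filter hattori_nbhs_singleton hattori_nbhs_nbhs.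

End HattoriTopology.

(* [G n] is a total function on sets; only its values at closed sets matter. *)
Definition semi_stratifiable (X : topologicalType) : Prop :=
  exists G : nat -> set X -> set X,
    [/\ forall n H, closed H -> open (G n H) /\ H `<=` G n H,
        forall H, closed H -> H = \bigcap_n G n H &
        forall n H K, closed H -> closed K -> H `<=` K -> G n H `<=` G n K].

(* Main.v *)
(* If [~` A] is countable, shrinking the basic neighbourhoods to radius [1/n]
   and deleting from those of [x] the first [n] points of [~` A] other than [x]
   yields [G]: a point in every [G n H] is a Euclidean limit of points of [H]
   if it lies in [A], and is eventually its own witness in [H] otherwise.
   Conversely, for [b] outside [A] the ray [`]-oo, b[] is closed, so
   [b] avoids [G n `]-oo, b[] for some [n]. By monotonicity, the points [b] that
   share the same [n] avoid [G n [set x]] for every [x < b]; each of them is thus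
   isolated from the right among them, so there are countably many for each [n]. *)
Require Import Defs.
From mathcomp Require Import all_boot all_order all_algebra.
From mathcomp Require Import all_classical all_reals all_analysis.

Set Implicit Arguments.
Unset Strict Implicit.
Unset Printing Implicit Defensive.

Import Order.TTheory GRing.Theory Num.Theory.
Import numFieldNormedType.Exports.

Local Open Scope classical_set_scope.
Local Open Scope ring_scope.

(** The gap to the right of each point of [D] contains a rational, and that rational determines the
    point as the last one of [D] before it. *)
Lemma countable_right_isolated (R : realType) (D : set R) :
  (forall b, D b -> exists2 e, 0 < e & forall c, D c -> b < c -> b + e <= c) ->
  countable D.
Proof.
move=> isoD.
pose above (q : rat) b := [/\ D b, b < ratr q &
  forall c, D c -> b < c -> ratr q <= c].
have above_uniq q b c : above q b -> above q c -> b = c.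
  move=> [Db bq hb] [Dc cq hc]; case: (ltgtP b c) => // [bc|cb].
    by have := hb _ Dc bc; rewrite leNgt cq.
  by have := hc _ Db cb; rewrite leNgt bq.
(* Rationals in no gap give the default 0, which is harmless as only an inclusion is needed. *)
suff sub : D `<=` [set xget 0 (above q) | q in [set: rat]].
  apply: sub_countable (subset_card_le sub) _.
  by apply: sub_countable (card_image_le _ _) _; exact: countableP.
move=> b Db; have [e e0 he] := isoD b Db.
have [q] := rat_in_itvoo (ltr_pwDr e0 (lexx b)).
rewrite in_itv /= => /andP[bq qbe].
have abq : above q b.
  by split=> // c Dc bc; apply: le_trans (ltW qbe) _; exact: he.
by exists q => //; case: xgetP => [c _ /above_uniq|/(_ b)]; [exact|].
Qed.

Section HattoriSpace.
Context (R : realType) (A : set R).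

Lemma hattori_base_itv (x e y : R) : hattori_base A x e y -> x - e < y < x + e.
Proof.
rewrite /hattori_base; case: ifP => _ /=; rewrite in_itv //= => /andP[xy ye].
rewrite ye andbT (lt_le_trans _ xy)// ltrBlDr ltrDl.
by rewrite -(ltrD2l x) addr0 (le_lt_trans xy).
Qed.

Lemma open_hattori_base (x : hattori A) (e : R) :
  open (hattori_base A x e : set (hattori A)).
Proof. by rewrite openE => y /hattori_base_sub[d d0 yd]; exists d. Qed.

Lemma open_hattori (U : set R) : open U -> open (U : set (hattori A)).
Proof.
rewrite !openE => oU x /oU /nbhs_ballP[e /= e0 xU].
exists e => // y /hattori_base_itv xy; apply: xU.
by rewrite /ball /= ltr_distlC.
Qed.

Lemma closed_hattori (F : set R) : closed F -> closed (F : set (hattori A)).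
Proof. by move=> cF; rewrite -openC; apply: open_hattori; rewrite openC. Qed.

Lemma closed_hattori_ray (b : R) : ~ A b ->
  closed ([set` `]-oo, b[] : set (hattori A)).
Proof.
move=> nAb; rewrite -openC openE => y /=; rewrite in_itv /= => /negP.
rewrite -leNgt le_eqVlt => /predU1P[<-|yb].
  (* At [b] itself any radius works: its basic neighbourhoods do not extend to the left. *)
  exists 1 => //= z; rewrite /hattori_base memNset //= !in_itv /= => /andP[bz _].
  by apply/negP; rewrite -leNgt.
exists (y - b) => /=; first by rewrite subr_gt0.
move=> z /hattori_base_itv /andP[]; rewrite subKr => bz _ /=.
by rewrite in_itv /=; apply/negP; rewrite -leNgt ltW.
Qed.

Lemma countable_of_semi_stratifiable :
  semi_stratifiable (hattori A) -> countable (~` A).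
Proof.
move=> [G [Gopen Gcap Gmono]].
pose B n := [set b | ~ A b /\ ~ G n [set` `]-oo, b[] b].
have -> : ~` A = \bigcup_n B n.
  apply/seteqP; split=> [b nAb|b [n _ []] //].
  apply: contrapT => nB; have : [set` `]-oo, b[] b.
    rewrite (Gcap _ (closed_hattori_ray nAb)) => n _.
    by apply: contrapT => nG; apply: nB; exists n.
  by rewrite /= in_itv /= ltxx.
apply: bigcup_countable => // n _; apply: countable_right_isolated => b [nAb nGb].
have cl1 : closed ([set b] : set (hattori A)).
  by apply: closed_hattori; exact: closed_eq.
have [oG sG] := Gopen n _ cl1.
have [e e0 heG] : nbhs (b : hattori A) (G n [set b]).
  by apply: open_nbhs_nbhs; split=> //; exact: sG.
(* If [c < b + e], then [c] lies in [G n [set b]], hence in the larger value of [G n] at the ray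
   below [c]. *)
exists e => // c [nAc nGc] bc; rewrite leNgt; apply/negP => cbe; apply: nGc.
have : G n [set b] c.
  by apply: heG; rewrite /hattori_base memNset //= in_itv /= (ltW bc).
apply: Gmono => //; first exact: closed_hattori_ray.
by move=> x ->; rewrite /= in_itv.
Qed.

Lemma semi_stratifiable_of_countable :
  countable (~` A) -> semi_stratifiable (hattori A).
Proof.
move=> /countable_injP[f finj].
(* With the bound [n.+1], a point [y] outside [A] is deleted already at stage [f y]. *)
pose E n x := [set y : R | [/\ ~ A y, (f y < n.+1)%N & y <> x]].
pose g n (x : R) := hattori_base A x n.+1%:R^-1 `\` E n x.
have g_refl n x : g n x x.
  by split; [apply: hattori_base_refl; rewrite invr_gt0 ltr0n|case].
have E_closed n x : closed (E n x : set (hattori A)).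
  apply: closed_hattori.
  apply: (accessible_finite_set_closed.1 (hausdorff_accessible (@Rhausdorff R))).
  (* Finiteness transfers back to [E n x] because [f] is injective outside [A]. *)
  have : finite_set (f @` E n x).
    by apply: (sub_finite_set _ (finite_II n.+1)) => _ [y [_ fy _] <-].
  rewrite (@eq_finite_set _ _ _ (E n x)) //; apply: inj_card_eq.
  move=> y z /set_mem[nAy _ _] /set_mem[nAz _ _]; apply: finj; exact: mem_set.
have g_open n x : open (g n x : set (hattori A)).
  rewrite /g setDE; apply: openI; first exact: open_hattori_base.
  by rewrite openC; exact: E_closed.
exists (fun n H => \bigcup_(x in H) g n x); split.
- move=> n H _; split; first by apply: bigcup_open => x _; exact: g_open.
  by move=> x Hx; exists x.
- move=> H cH; apply/seteqP; split=> [x Hx n _|y Gy]; first by exists x.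
  have [Ay|nAy] := pselect (A y); last first.
    have [x Hx [_ nE]] := Gy (f y) I.
    have [<- //|yx] := pselect (x = y).
    by exfalso; apply: nE; split=> // /esym.
  (* Neighbourhoods of [y] in [A] are two-sided, so it suffices to find points of [H] at Euclidean
     distance less than [e]. *)
  apply: cH => U [e /= e0 yU].
  have [n ne] : exists n : nat, n.+1%:R^-1 < e.
    have [n _ /(_ n (leqnn n))] := near_infty_natSinv_lt (PosNum e0).
    by exists n.
  have [x Hx [/hattori_base_itv /andP[xy yx] _]] := Gy n I.
  exists x; split=> //; apply: yU; rewrite /hattori_base mem_set //= in_itv /=.
  rewrite ltrBlDr (lt_le_trans yx) ?lerD2l ?(ltW ne) //=.
  by move: xy; rewrite ltrBlDr => /lt_le_trans; apply; rewrite lerD2l ltW.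
- by move=> n H K _ _ HK y [x /HK Kx gy]; exists x.
Qed.

End HattoriSpace.

Theorem proposition5 (R : realType) (A : set R) :
  semi_stratifiable (hattori A) <-> countable (~` A).
Proof.
split.
  exact: countable_of_semi_stratifiable.
exact: semi_stratifiable_of_countable.
Qed.
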